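(* Let $G$ be a connected bipartite graph of order $n\geq 4$. If $d(x)+d(y)\geq \frac{n+6}{4}$ for every pair of nonadjacent vertices $x,y\in V(G)$, then $pc(G)=2$.
   Context: All graphs are finite, simple and undirected; $d(v)$ denotes the degree of a vertex $v$. An edge-coloring of $G$ assigns colors to edges, adjacent edges being allowed the same color. A path is proper if no two adjacent edges of the path have the same color. An edge-coloring of a connected graph $G$ is a proper connection coloring if every pair of distinct vertices of $G$ is joined by a proper path. The proper connection number $pc(G)$ of a connected graph $G$ is the minimum number of colors in a proper connection coloring of $G$. *)

(* Defs.v *)
From mathcomp Require Import all_boot all_order all_algebra.

Set Implicit Arguments.
Unset Strict Implicit.
Unset Printing Implicit Defensive.

Import Order.TTheory GRing.Theory Num.Theory.

(* A finite simple graph is a symmetric irreflexive relation [e] on a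
   finType; these two properties are hypotheses of the theorem. *)
Section Graph.

Variables (V : finType) (e : rel V).

Definition degree (x : V) : nat := #|[set y | e x y]|.

Definition edges : {set {set V}} :=
  [set [set p.1; p.2] | p in [set p : V * V | e p.1 p.2]].

Definition connected_graph : Prop :=
  0 < #|V| /\ forall x y : V, connect e x y.

Definition bipartite : Prop :=
  exists A : {set V}, forall x y : V, e x y -> (x \in A) != (y \in A).

(* An edge-coloring is a function on vertex sets of which only the values on
   [edges] matter. *)
Definition coloring := {set V} -> nat.

Definition num_colors (c : coloring) : nat :=
  size (undup [seq c E | E <- enum edges]).

Definition path_edges (x : V) (p : seq V) : seq {set V} :=
  pairmap (fun u v => [set u; v]) x p.

(* The vertices of the path are [x :: p]. Two edges of a path are adjacent
   exactly when they are consecutive, which is what [sorted] compares. *)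
Definition proper_path (c : coloring) (x y : V) (p : seq V) : bool :=
  [&& path e x p, uniq (x :: p), last x p == y &
      sorted (fun E F => c E != c F) (path_edges x p)].

Definition proper_connection_coloring (c : coloring) : Prop :=
  forall x y : V, x != y -> exists p : seq V, proper_path c x y p.

(* [is_pc k] states pc(G) = k. *)
Definition is_pc (k : nat) : Prop :=
  (exists2 c : coloring, proper_connection_coloring c & num_colors c = k) /\
  (forall c : coloring, proper_connection_coloring c -> k <= num_colors c).

End Graph.

(* Main.v *)
Require Import Defs.
From mathcomp Require Import all_boot all_order all_algebra.
From mathcomp Require Import zify.

Import Order.TTheory GRing.Theory Num.Theory.

(** Let [A] be one side of the bipartition. Given an orientation of [G], colour
    an edge by whether its tail lies in [A]: then directed paths, read in either
    direction, are proper. So it suffices to orient [G] such that of any two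
    vertices one reaches the other. Non-bridges are oriented as in Robbins'
    theorem, keeping reachability, and bridges are oriented away from a root
    [a]. If [x] and [y] are still incomparable, their sets of reachable vertices
    are disjoint and each is joined to the rest by a single bridge. A set of the
    latter kind without pendant vertices contains an edge [ww'] with
    [d(w) + d(w')] at most its size, and none of its vertices but one has
    neighbours outside, so that the degree condition applies across such sets.
    For [a] a pendant vertex, or else the end in [X0] of the bridge bounding a
    smallest such set [X0], counting gives more than [n] vertices. *)

(** * Reachability, confined walks and deleted edges *)

Section Reachability.

Variable V : finType.
Implicit Types (r d e : rel V) (X Y : {set V}).

Lemma connect_ind r (P : V -> Prop) a :
    P a -> (forall x y, connect r a x -> P x -> r x y -> P y) ->
  forall x, connect r a x -> P x.
Proof.
move=> Pa Pstep x /connectP[p].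
elim/last_ind: p x => [|p z IH] x /=; first by move=> _ ->.
rewrite rcons_path last_rcons => /andP[rp rz] ->.
apply: (Pstep (last a p)) => //; last exact: IH.
by apply/connectP; exists p.
Qed.

Lemma connect_revE r x y : connect [rel u v | r v u] x y = connect r y x.
Proof.
have half (s : rel V) u v : connect s u v -> connect [rel u v | s v u] v u.
  elim/connect_ind => // {}u0 z _ IH s_z.
  exact: connect_trans (connect1 (_ : [rel u v | s v u] z u0)) IH.
by apply/idP/idP => /half.
Qed.

Definition restrict r X : rel V := [rel x y | [&& r x y, x \in X & y \in X]].

Lemma restrict_mem r X a x : a \in X -> connect (restrict r X) a x -> x \in X.
Proof. by move=> aX; elim/connect_ind: x / => // x y _ _ /and3P[]. Qed.

Lemma connect_restrict r X a x :
    a \in X -> (forall p q, p \in X -> r p q -> q \in X) ->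
  connect r a x -> connect (restrict r X) a x.
Proof.
move=> aX Xcl; elim/connect_ind: x / => // x y _ ax rxy.
have xX := restrict_mem _ _ _ _ aX ax.
apply: connect_trans ax (connect1 _).
by rewrite /restrict /= rxy xX (Xcl _ _ xX rxy).
Qed.

(** The walk is cut at its first edge out of [X]. What precedes stays in [X], and so avoids every
    edge with an end outside [X]. *)
Lemma connect_exit r X a x : connect r a x -> a \in X -> x \notin X ->
  exists p q, [/\ connect (restrict r X) a p, r p q, p \in X & q \notin X].
Proof.
move=> ax aX xNX.
have [|//] : connect (restrict r X) a x \/ exists p q,
    [/\ connect (restrict r X) a p, r p q, p \in X & q \notin X].
  elim/connect_ind: x / ax {xNX} => [|x y _ [ax|E] rxy]; [by left| |by right].
  have xX := restrict_mem _ _ _ _ aX ax.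
  have [yX|yX] := boolP (y \in X); last by right; exists x, y.
  left; apply: connect_trans ax (connect1 _).
  by rewrite /restrict /= rxy xX.
by move/(restrict_mem _ _ _ _ aX); rewrite (negPf xNX).
Qed.

Definition del_edge r u v : rel V :=
  [rel x y | [&& r x y, (x, y) != (u, v) & (x, y) != (v, u)]].

Lemma sub_del_edge r u v : subrel (del_edge r u v) r.
Proof. by move=> x y /and3P[]. Qed.

Lemma del_edgeC r u v : del_edge r u v =2 del_edge r v u.
Proof. by move=> x y; rewrite /del_edge /= [X in _ && X]andbC. Qed.

Lemma del_edge_sym r u v : symmetric r -> symmetric (del_edge r u v).
Proof.
move=> r_sym x y; rewrite /del_edge /= r_sym !xpair_eqE.
by rewrite ![(y == _) && _]andbC [X in _ && X]andbC.
Qed.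

Lemma connect_del_edgeC r u v x y :
  connect (del_edge r u v) x y = connect (del_edge r v u) x y.
Proof. exact: eq_connect (del_edgeC r u v) x y. Qed.

Lemma restrict_del_edge r X p q x y : (p \notin X) || (q \notin X) ->
  restrict r X x y -> del_edge r p q x y.
Proof.
move=> H /and3P[rxy xX yX]; rewrite /del_edge /= rxy !xpair_eqE /=.
apply/andP; split; apply/negP => /andP[/eqP ? /eqP ?]; subst;
  by rewrite xX yX in H.
Qed.

Lemma connect_restrict_del_edge r X p q x y : (p \notin X) || (q \notin X) ->
  connect (restrict r X) x y -> connect (del_edge r p q) x y.
Proof.
move=> H; apply: connect_sub => u v uv; apply: connect1.
exact: restrict_del_edge uv.
Qed.

Lemma connect_subrel r r' x y : subrel r r' -> connect r x y -> connect r' x y.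
Proof. by move=> rr'; apply: connect_sub => u v /rr' /connect1. Qed.

(** * Robbins' theorem for graphs that need not be connected *)

Section Robbins.

Variable r : rel V.
Hypotheses (r_sym : symmetric r) (r_irr : irreflexive r).
Hypothesis r_bridgeless : forall u v, r u v -> connect (del_edge r u v) u v.

(* The inductive step of Boesch and Tindell's version of Robbins' theorem for
   mixed graphs: a two-way edge stands for one that is not oriented yet. *)
Lemma orient_two_way d u v : subrel d r ->
    (forall x y, r x y -> d x y || d y x) ->
    (forall x y, connect r x y -> connect d x y) ->
    d u v -> d v u ->
  connect (del_edge d u v) u v || connect (del_edge d u v) v u.
Proof.
move=> d_sub d_cov d_conn duv dvu; set d' := del_edge d u v.
have [//|/negP uNv] := boolP (connect d' u v).
have [//|/negP vNu] := boolP (connect d' v u); exfalso; apply: (uNv).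
have r_csym : connect_sym r by apply: sym_connect_sym.
(* A walk from [u] that uses [uv] is cut after the last use; the rest starts at [u] or [v]. *)
have fromP y : connect d u y -> connect d' u y \/ connect d' v y.
  elim/connect_ind: y / => [|x y _ IH dxy]; first by left.
  have [/andP[/eqP _ /eqP->]|N1] := boolP ((x == u) && (y == v)); first by right.
  have [/andP[/eqP _ /eqP->]|N2] := boolP ((x == v) && (y == u)); first by left.
  have d'xy : d' x y by rewrite /d' /del_edge /= dxy !xpair_eqE N1 N2.
  by case: IH => IH; [left|right]; apply: connect_trans IH (connect1 d'xy).
have toP x : connect d x u -> connect d' x u \/ connect d' x v.
  rewrite -connect_revE; elim/connect_ind: x / => [|y x _ IH /= dxy]; first by left.
  have [/andP[/eqP-> /eqP _]|N1] := boolP ((x == u) && (y == v)); first by left.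
  have [/andP[/eqP-> /eqP _]|N2] := boolP ((x == v) && (y == u)); first by right.
  have d'xy : d' x y by rewrite /d' /del_edge /= dxy !xpair_eqE N1 N2.
  by case: IH => IH; [left|right]; apply: connect_trans (connect1 d'xy) IH.
have ruv := r_bridgeless _ _ (d_sub _ _ duv).
suff all_y y : connect (del_edge r u v) u y -> connect d' u y by apply: all_y.
elim/connect_ind: y / => // x y ux IH /and3P[rxy N1 N2].
have ux' : connect r u x by apply: connect_subrel ux; apply: sub_del_edge.
have uy' : connect r u y by apply: connect_trans ux' (connect1 rxy).
have /orP[dxy|dyx] := d_cov _ _ rxy.
  by apply: connect_trans IH (connect1 _); rewrite /d' /del_edge /= dxy N1.
have d'yx : d' y x.
  rewrite /d' /del_edge /= dyx; move: N1 N2; rewrite !xpair_eqE.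
  by rewrite ![(y == _) && _]andbC => -> ->.
(* If [v] reaches [y], it reaches [x] over [yx]. As [x] reaches [u] or [v], this joins [v] to [u]
   or, through [x], [u] to [v]. *)
have [//|vy] := fromP _ (d_conn _ _ uy').
have vx : connect d' v x by apply: connect_trans vy (connect1 d'yx).
have [xu|xv] := toP x (d_conn _ _ (etrans (r_csym _ _) ux')).
  by case: vNu; apply: connect_trans vx xu.
by case: uNv; apply: connect_trans IH xv.
Qed.

(** Directions of two-way edges are dropped one by one, as [orient_two_way] permits. Reachability is
    kept in place of strong connectivity, since [r] may be disconnected. *)
Theorem robbins_orientation : exists d : rel V,
  [/\ subrel d r, forall x y, r x y -> d x y || d y x,
      forall x y, d x y -> ~~ d y x
    & forall x y, connect r x y -> connect d x y].
Proof.
pose R (D : {set V * V}) : rel V := [rel x y | (x, y) \in D].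
pose P (D : {set V * V}) := [forall x, forall y, (R D x y ==> r x y) &&
   (r x y ==> (R D x y || R D y x) && connect (R D) x y)].
pose D0 := [set p | r p.1 p.2].
have RD0 : R D0 =2 r by move=> x y; rewrite /R /= inE.
have PD0 : P D0.
  apply/forallP=> x; apply/forallP=> y; rewrite !RD0 implybb /=.
  apply/implyP=> rxy; rewrite rxy /=; apply: connect1; by rewrite RD0.
have PP D : P D -> [/\ subrel (R D) r, forall x y, r x y -> R D x y || R D y x
    & forall x y, connect r x y -> connect (R D) x y].
  move=> /forallP PD.
  have H x y := andP (forallP (PD x) y).
  split=> [x y RD|x y rxy|x y].
  - by have [/implyP->] := H x y.
  - by have [_ /implyP/(_ rxy)/andP[]] := H x y.
  - by apply: connect_sub => u v ruv; have [_ /implyP/(_ ruv)/andP[]] := H u v.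
(* A smallest admissible [D] has no two-way edge. *)
case: (@arg_minnP _ D0 P (fun D => #|D|) PD0) => D PD Dmin.
have [d_sub d_cov d_conn] := PP D PD.
exists (R D); split=> //.
have noloss u v : R D u v -> R D v u -> connect (del_edge (R D) u v) u v -> False.
  move=> duv dvu uv; have uNv : u != v.
    by apply: contraTneq (d_sub _ _ duv) => ->; rewrite r_irr.
  have := Dmin (D :\ (u, v)); rewrite (cardsD1 (u, v) D) (_ : (u, v) \in D) //.
  rewrite ltnn => /(_ _)/notF; apply.
  have sub1 x y : R (D :\ (u, v)) x y -> R D x y by rewrite /R /= !inE => /andP[].
  have keep x y : (x, y) != (u, v) -> R D x y -> R (D :\ (u, v)) x y.
    by move=> N dxy; rewrite /R /= !inE N.
  have vu : R (D :\ (u, v)) v u.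
    by apply: keep dvu; rewrite xpair_eqE eq_sym (negPf uNv).
  have dconn x y : R D x y -> connect (R (D :\ (u, v))) x y.
    have [[-> ->] _|N /(keep _ _ N)/connect1 //] := eqVneq (x, y) (u, v).
    by apply: connect_subrel uv => a b /and3P[ab N _]; apply: keep.
  apply/forallP=> x; apply/forallP=> y; apply/andP; split; apply/implyP.
    by move/sub1/d_sub.
  move=> rxy; apply/andP; split; last first.
    exact: (connect_sub dconn) (d_conn _ _ (connect1 rxy)).
  have /orP[d1|d1] := d_cov _ _ rxy.
    have [[-> ->]|N] := eqVneq (x, y) (u, v); first by rewrite vu orbT.
    by rewrite keep.
  have [[-> ->]|N] := eqVneq (y, x) (u, v); first by rewrite vu.
  by rewrite [X in _ || X]keep ?orbT.
move=> u v duv; apply/negP => dvu.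
have /orP[H|H] := orient_two_way _ _ _ d_sub d_cov d_conn duv dvu.
  exact: noloss H.
by apply: (noloss v u) => //; rewrite connect_del_edgeC.
Qed.

End Robbins.

(** * Bridges, and orientation away from a root *)

Section ConnectedGraph.

Variable e : rel V.
Hypotheses (e_sym : symmetric e) (e_irr : irreflexive e).
Hypothesis e_conn : forall x y, connect e x y.

Definition nonbridge : rel V :=
  [rel x y | e x y && connect (del_edge e x y) x y].

Lemma connect_del_edge_sym p q : connect_sym (del_edge e p q).
Proof. exact/sym_connect_sym/del_edge_sym. Qed.

Lemma nonbridge_sym : symmetric nonbridge.
Proof.
by move=> x y; rewrite /nonbridge /= e_sym connect_del_edgeC connect_del_edge_sym.
Qed.

(** Every edge of a cycle is a non-bridge, so cycles survive the removal of bridges. This is the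
    hypothesis of [robbins_orientation] for [nonbridge]. *)
Lemma nonbridge_cycle u v :
  nonbridge u v -> connect (del_edge nonbridge u v) u v.
Proof.
move=> nb_uv; have /andP[euv uv] := nb_uv.
pose X := [set x | connect (del_edge nonbridge u v) u x].
have Xcl p q : p \in X -> del_edge nonbridge u v p q -> q \in X.
  by rewrite !inE => up pq; apply: connect_trans up (connect1 pq).
have uX : u \in X by rewrite inE connect0.
(* A walk avoiding [uv] that leaves [X] does so over a bridge [pq]; until it
   comes back to [p] it stays on the far side of [pq]. *)
have all_y y : connect (del_edge e u v) u y -> y \in X \/ exists p q,
    [/\ p \in X, q \notin X, del_edge e u v p q, ~~ nonbridge p q
      & connect (del_edge e p q) q y].
  elim/connect_ind: y / => [|x y _ IH exy]; first by left.
  case: IH => [xX|[p [q [pX qX epq nbpq qx]]]].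
    have [yX|yX] := boolP (y \in X); [by left|right].
    exists x, y; split=> //; apply: contra yX => nbxy.
    by apply: Xcl xX _; case/and3P: exy => _ N1 N2; rewrite /del_edge /= nbxy N1.
  have [[_ ->]|N1] := eqVneq (x, y) (p, q).
    by right; exists p, q; split; rewrite ?connect0.
  have [[_ ->]|N2] := eqVneq (x, y) (q, p); first by left.
  right; exists p, q; split=> //; apply: connect_trans qx (connect1 _).
  by rewrite /del_edge /= (sub_del_edge _ _ _ _ _ exy) N1.
have [|[p [q [pX qX epq nbpq qv]]]] := all_y v uv; first by rewrite inE.
have /and3P[epq' N1 N2] := epq.
(* The bridge [pq] is bypassed: from [q] to [v], over [vu], and from [u] to [p] inside [X]. *)
case/negP: nbpq; rewrite /nonbridge /= epq' connect_del_edge_sym.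
apply: connect_trans qv _; apply: (@connect_trans _ _ u).
  rewrite connect_del_edge_sym; apply: connect1.
  rewrite /del_edge /= euv /=; apply/andP; split.
    by apply: contraNneq N1 => -[-> ->].
  by apply: contraNneq N2 => -[-> ->].
have := connect_restrict _ _ _ _ uX Xcl (_ : connect _ u p).
rewrite inE in pX; move=> /(_ pX) up.
apply: (connect_restrict_del_edge _ X); first by rewrite qX orbT.
apply: connect_subrel up => x y /and3P[/sub_del_edge/andP[exy _] xX yX].
by rewrite /restrict /= exy xX.
Qed.

(* Bridges are oriented away from [a]; all other edges keep both directions. *)
Definition away a : rel V :=
  [rel x y | e x y && connect (del_edge e x y) a x].

(** The component of [a] left by deleting [xy] can be exited only over [xy], so it contains [x] or
    [y]. *)
Lemma away_cover a x y : e x y -> away a x y || away a y x.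
Proof.
move=> exy; rewrite /away /= exy e_sym exy /=.
apply/orP; have [|] := boolP (connect (del_edge e x y) a x); first by left.
have [|] := boolP (connect (del_edge e x y) a y).
  by rewrite connect_del_edgeC; right.
move=> yN xN; have aX : a \in [set z | connect (del_edge e x y) a z].
  by rewrite inE.
have xX : x \notin [set z | connect (del_edge e x y) a z] by rewrite inE.
have [p [q [_ epq]]] := connect_exit _ _ _ _ (e_conn a x) aX xX.
rewrite !inE => ap /negP[]; apply: connect_trans (ap) (connect1 _).
rewrite /del_edge /= epq /=; apply/andP; split.
  by apply: contraNneq xN => -[px _]; rewrite px in ap.
by apply: contraNneq yN => -[py _]; rewrite py in ap.
Qed.

Lemma away_two_way a x y : away a x y -> away a y x -> nonbridge x y.
Proof.
move=> /andP[exy ax] /andP[_ ay]; rewrite /nonbridge /= exy /=.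
rewrite connect_del_edgeC in ay; apply: connect_trans ay.
by rewrite connect_del_edge_sym.
Qed.

(** The first edge [pq] out of the reached set has not been used before, so it is directed away from
    [a] and [q] is reached after all. *)
Lemma away_root a x : connect (away a) a x.
Proof.
pose X := [set z | connect (away a) a z].
have Xcl p q : p \in X -> away a p q -> q \in X.
  by rewrite !inE => ap pq; apply: connect_trans ap (connect1 pq).
have aX : a \in X by rewrite inE.
have [|xX] := boolP (x \in X); first by rewrite inE.
have [p [q [ap epq pX qX]]] := connect_exit _ _ _ _ (e_conn a x) aX xX.
case/negP: (qX); apply: Xcl pX _; rewrite /away /= epq.
by apply: (connect_restrict_del_edge _ X) ap; rewrite qX orbT.
Qed.

(** On bridges [away a] has one direction only, by [away_two_way]; its steps over non-bridges are
    replaced by paths of Robbins' orientation. *)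
Lemma bridge_orientation a : exists D : rel V,
  [/\ subrel D e, forall x y, D x y -> ~~ D y x
    & forall x y, connect (away a) x y -> connect D x y].
Proof.
have nb_irr : irreflexive nonbridge by move=> x; rewrite /nonbridge /= e_irr.
have [d [d_sub _ d_anti d_conn]] :=
  robbins_orientation _ nonbridge_sym nb_irr nonbridge_cycle.
exists [rel x y | d x y || (away a x y && ~~ nonbridge x y)]; split=> [x y|x y|x y] /=.
- by case/orP => [/d_sub/andP[]|/andP[/andP[]]].
- case/orP => [dxy|/andP[axy nbxy]]; rewrite negb_or negb_and negbK.
    by rewrite d_anti //= nonbridge_sym d_sub ?orbT.
  rewrite -[nonbridge y x]nonbridge_sym (negPf nbxy) orbF; apply/andP; split.
    by apply: contra nbxy => /d_sub; rewrite nonbridge_sym.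
  by apply: contra nbxy; apply: away_two_way.
- apply: connect_sub => u v auv.
  have [nb|nb] := boolP (nonbridge u v); last by apply: connect1; rewrite /= auv nb orbT.
  by apply: connect_subrel (d_conn _ _ (connect1 nb)) => x' y' /= ->.
Qed.

(** * Vertex sets bounded by a single bridge *)

(** [X] is one shore of the bridge [vu]. The form is boolean so that a smallest such [X] can be
    chosen. *)
Definition is_side X v u := [&& v \in X, u \notin X, e v u &
  [forall p, forall q, [&& p \in X, q \notin X & e p q] ==> (p == v) && (q == u)]].

Lemma is_sideP X v u :
  reflect [/\ v \in X, u \notin X, e v u &
             forall p q, p \in X -> q \notin X -> e p q -> p = v /\ q = u]
          (is_side X v u).
Proof.
apply: (iffP and4P) => -[vX uX evu H]; split=> //.
  move=> p q pX qX epq; have /forallP/(_ q) := forallP H p.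
  by rewrite pX qX epq => /andP[/eqP-> /eqP->].
apply/forallP=> p; apply/forallP=> q; apply/implyP=> /and3P[pX qX epq].
by have [-> ->] := H _ _ pX qX epq; rewrite !eqxx.
Qed.

Definition reach a x := [set z | connect (away a) x z].

Lemma reach_refl a x : x \in reach a x.
Proof. by rewrite inE. Qed.

Lemma reach_closed a x p q : p \in reach a x -> away a p q -> q \in reach a x.
Proof. by rewrite !inE => xp pq; apply: connect_trans xp (connect1 pq). Qed.

Lemma reach_restrict a x z :
  z \in reach a x -> connect (restrict e (reach a x)) x z.
Proof.
rewrite inE => xz.
have := connect_restrict _ _ _ _ (reach_refl a x) (reach_closed a x) xz.
by apply: connect_subrel => u v /and3P[/andP[euv _] uX vX]; rewrite /restrict /= euv uX.
Qed.

(** Let a walk from [a] first enter the set over [uv]. If another edge [pq] left the set, [a] would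
    reach [p] without it, through [u], [v] and the inside of the set, so that [q] would belong to
    the set. *)
Lemma reach_side a x : a \notin reach a x -> exists v u,
  [/\ is_side (reach a x) v u, away a u v & connect (away a) v x].
Proof.
set X := reach a x => aX.
have xX : x \in X by apply: reach_refl.
have [u [v [au euv uX vX]]] : exists u v,
    [/\ connect (restrict e (~: X)) a u, e u v, u \in ~: X & v \notin ~: X].
  by apply: connect_exit (e_conn a x) _ _; rewrite in_setC ?aX ?xX.
rewrite !in_setC ?negbK in uX vX.
have X_sym : connect_sym (restrict e X).
  by apply: sym_connect_sym => y z; rewrite /restrict /= e_sym [X in _ && X]andbC.
have uniq_edge p q : p \in X -> q \notin X -> e p q -> p = v /\ q = u.
  move=> pX qX epq.
  have [[-> ->] //|N1] := eqVneq (p, q) (v, u); exfalso.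
  case/negP: (qX); apply: reach_closed (pX) _; rewrite /away /= epq /=.
  apply: (@connect_trans _ _ u).
    by apply: (connect_restrict_del_edge _ (~: X)) au; rewrite !in_setC pX.
  apply: (@connect_trans _ _ v).
    apply: connect1; rewrite /del_edge /= euv /=; apply/andP; split.
      by apply: contraTneq pX => -[<- _].
    by apply: contraNneq N1 => -[-> ->].
  apply: (connect_restrict_del_edge _ X); first by rewrite qX orbT.
  apply: (@connect_trans _ _ x); last exact: reach_restrict.
  by rewrite X_sym; apply: reach_restrict.
have vNu : ~~ away a v u.
  by apply: contra uX; apply: reach_closed.
exists v, u; split.
- by apply/is_sideP; split=> //; rewrite e_sym.
- by have /orP[//|] := away_cover a _ _ euv; rewrite (negPf vNu).
suff enter z : connect (away a) a z -> z \in X -> connect (away a) v z.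
  by apply: enter xX; apply: away_root.
elim/connect_ind: z / => [|y z _ IH ayz zX]; first by rewrite (negPf aX).
have [yX|yX] := boolP (y \in X); first exact: connect_trans (IH yX) (connect1 ayz).
have /andP[eyz _] := ayz; rewrite e_sym in eyz.
by have [-> _] := uniq_edge _ _ zX yX eyz; apply: connect0.
Qed.

(** A walk from [x], inside its set, to a common vertex enters the set of [y] over the bridge of
    [reach_side], at the end that reaches [y]. *)
Lemma reach_disjoint a x y :
    a \notin reach a x -> a \notin reach a y ->
    ~~ connect (away a) x y -> ~~ connect (away a) y x ->
  [disjoint reach a x & reach a y].
Proof.
move=> aX aY xNy yNx; apply/pred0P => w /=; apply/negP => /andP[wX wY].
have [v [u [/is_sideP[vY uY evu side_uniq] _ vy]]] := reach_side a y aY.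
have [q [p [xq /and3P[eqp qX pX] qY pY]]] : exists q p,
    [/\ connect (restrict (restrict e (reach a x)) (~: reach a y)) x q,
        restrict e (reach a x) q p, q \in ~: reach a y & p \notin ~: reach a y].
  apply: connect_exit (reach_restrict _ _ _ wX) _ _; rewrite in_setC ?wY //.
  by rewrite inE.
rewrite in_setC in qY; rewrite in_setC negbK in pY; rewrite e_sym in eqp.
have [pv _] := side_uniq _ _ pY qY eqp.
case/negP: xNy; apply: connect_trans vy; rewrite -pv.
by move: pX; rewrite inE.
Qed.

Lemma side_nbr X v u w y :
  is_side X v u -> w \in X -> w != v -> e w y -> y \in X.
Proof.
case/is_sideP=> _ _ _ H wX wv ewy; apply: contraNT wv => yX.
by have [->] := H _ _ wX yX ewy.
Qed.

Lemma degree_gt1_nbr x u : 1 < degree e x -> exists2 y, e x y & y != u.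
Proof.
rewrite /degree (cardsD1 u) => deg; have /card_gt0P[y] : 0 < #|[set y | e x y] :\ u|.
  by case: (u \in _) deg => /=; lia.
by rewrite !inE => /andP[yu exy]; exists y.
Qed.

(** * Counting degrees in sets bounded by one bridge *)

Variable A : {set V}.
Hypothesis e_bip : forall x y, e x y -> (x \in A) != (y \in A).

(** Adjacent vertices of a bipartite graph have disjoint neighbourhoods. *)
Lemma edge_degree_sum X w w' : e w w' ->
    (forall y, e w y -> y \in X) -> (forall y, e w' y -> y \in X) ->
  degree e w + degree e w' <= #|X|.
Proof.
move=> eww' wX w'X.
have dis : [set y | e w y] :&: [set y | e w' y] = set0.
  apply/setP=> y; rewrite !inE; apply/negP => /andP[/e_bip wy /e_bip w'y].
  by move: (e_bip _ _ eww') wy w'y; do 3!case: (_ \in A).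
rewrite /degree -cardsUI dis cards0 addn0; apply: subset_leq_card.
by apply/subsetP=> y; rewrite !inE => /orP[/wX|/w'X].
Qed.

Lemma side_edge X v u : is_side X v u -> (forall z, z \in X -> 1 < degree e z) ->
  exists w w', [/\ w \in X, w' \in X, w != v, w' != v
                 & degree e w + degree e w' <= #|X|].
Proof.
move=> sX deg; have /is_sideP[vX uX evu side_uniq] := sX.
have [w evw wu] := degree_gt1_nbr _ u (deg _ vX).
have wX : w \in X by apply: contraNT wu => wX; have [_ ->] := side_uniq _ _ vX wX evw.
have wv : w != v by apply: contraTneq evw => ->; rewrite e_irr.
have [w' eww' w'v] := degree_gt1_nbr _ v (deg _ wX).
have w'X := side_nbr _ _ _ _ _ sX wX wv eww'.
exists w, w'; split=> //; apply: edge_degree_sum => // y.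
  exact: side_nbr sX wX wv.
exact: side_nbr sX w'X w'v.
Qed.

Hypothesis n_ge4 : 4 <= #|V|.
Hypothesis deg_sum : forall x y, x != y -> ~~ e x y ->
  #|V| + 6 <= 4 * (degree e x + degree e y).

Lemma side_deg_sum X v u w t : is_side X v u -> w \in X -> w != v -> t \notin X ->
  #|V| + 6 <= 4 * (degree e w + degree e t).
Proof.
move=> sX wX wv tX; apply: deg_sum.
  by apply: contraNneq tX => <-.
by apply: contra tX; apply: side_nbr sX wX wv.
Qed.

(** Nonadjacent, the two would have degree sum at most 2, against [4 * 2 < n + 6]; adjacent, they
    would form a whole component, against [n >= 4]. *)
Lemma pendant_unique z t : degree e z <= 1 -> degree e t <= 1 -> z = t.
Proof.
move=> dz dt; apply/eqP; apply: contraT => zt.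
have [ezt|nzt] := boolP (e z t); last by have := deg_sum _ _ zt nzt; lia.
have only a b y : e a b -> degree e a <= 1 -> e a y -> y = b.
  move=> eab da eay; apply/eqP; apply: contraT => yb.
  suff : 1 < degree e a by lia.
  by apply/card_gt1P; exists y, b; split; rewrite ?inE.
have [/forallP H|/forallPn[y yN]] := boolP [forall y, y \in [set z; t]].
  have : #|[set: V]| <= #|[set z; t]| by apply: subset_leq_card; apply/subsetP.
  by rewrite cardsT cards2 zt; lia.
have [p [q [_ epq pX]]] := connect_exit _ _ _ _ (e_conn z y) (set21 z t) yN.
have etz : e t z by rewrite e_sym.
move: pX epq; rewrite !inE => /orP[/eqP->|/eqP->] epq.
  by rewrite (only _ _ _ ezt dz epq) eqxx orbT.
by rewrite (only _ _ _ etz dt epq) eqxx.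
Qed.

Lemma three_sides X0 X1 X2 v0 u0 v1 u1 v2 u2 t :
    is_side X0 v0 u0 -> is_side X1 v1 u1 -> is_side X2 v2 u2 ->
    [disjoint X0 & X1] -> [disjoint X0 & X2] -> [disjoint X1 & X2] ->
    (forall z, 1 < degree e z) ->
    t \notin X0 :|: X1 :|: X2 -> False.
Proof.
move=> s0 s1 s2 d01 d02 d12 deg tU; set U := X0 :|: X1 :|: X2 in tU.
have dis (X Y : {set V}) z : [disjoint X & Y] -> z \in Y -> z \notin X.
  by move=> XY zY; rewrite (disjointFl XY zY).
have cardU : #|U| = #|X0| + #|X1| + #|X2|.
  rewrite /U cardsU setIUl !disjoint_setI0 // setU0 cards0 subn0.
  by rewrite cardsU disjoint_setI0 // cards0 subn0.
have cardV := cardsC U.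
have [w0 [w0' [w0X w0X' w0v w0v' D0]]] := side_edge _ _ _ s0 (fun z _ => deg z).
have [w1 [w1' [w1X w1X' w1v w1v' D1]]] := side_edge _ _ _ s1 (fun z _ => deg z).
have [w2 [w2' [w2X w2X' w2v w2v' D2]]] := side_edge _ _ _ s2 (fun z _ => deg z).
have notU z : z \notin U -> [/\ z \notin X0, z \notin X1 & z \notin X2].
  by rewrite !in_setU !negb_or => /andP[/andP[]].
have attach X v u z y : is_side X v u -> z \notin X -> y \in X -> e z y -> y = v.
  move=> /is_sideP[_ _ _ H] zX yX ezy; rewrite e_sym in ezy.
  by have [->] := H _ _ yX zX ezy.
(* Vertices outside [U] have no neighbours in [U] but [v0], [v1], [v2]: the source of the constant
   3. *)
have nbrU z y : z \notin U -> e z y -> y \in ~: U :|: [set v0; v1; v2].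
  move=> zU ezy; have [z0 z1 z2] := notU z zU.
  rewrite in_setU in_setC; have [yU|//] := boolP (y \in U).
  move: yU; rewrite !in_setU => /orP[/orP[]|] yX; rewrite !inE.
  - by rewrite (attach _ _ _ _ _ s0 z0 yX ezy) eqxx.
  - by rewrite (attach _ _ _ _ _ s1 z1 yX ezy) eqxx orbT.
  - by rewrite (attach _ _ _ _ _ s2 z2 yX ezy) eqxx !orbT.
have card3 : #|[set v0; v1; v2]| <= 3.
  by rewrite -setUA !cardsU1 cards1; do 2!case: (_ \notin _).
have far w X v u z : is_side X v u -> w \in X -> w != v -> X \subset U -> z \notin U ->
    #|V| + 6 <= 4 * (degree e w + degree e z).
  move=> sX wX wv XU zU; apply: side_deg_sum sX wX wv _.
  by apply: contra zU; apply: (subsetP XU).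
have sub0 : X0 \subset U by rewrite /U -setUA subsetUl.
have sub1 : X1 \subset U by rewrite /U setUAC subsetUr.
have sub2 : X2 \subset U by rewrite subsetUr.
(* With [s = (n+6)/4]: an edge [tt'] outside the three sets satisfies
   [d(t) + d(t') <= |V \ U| + 3], whence [4s <= n + 3]. Otherwise [d(t) <= 3],
   whence [6(s - 3) <= n - 1], while [3s <= n - 1]. *)
have [/existsP[t' /andP[ett' t'U]]|/existsPn no_nbr] :=
    boolP [exists t', e t t' && (t' \notin U)].
  have Dt : degree e t + degree e t' <= #|~: U :|: [set v0; v1; v2]|.
    by apply: edge_degree_sum => // y; apply: nbrU.
  have := cardsU (~: U) [set v0; v1; v2].
  have := side_deg_sum _ _ _ _ _ s0 w0X w0v (dis _ _ _ d01 w1X).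
  have := side_deg_sum _ _ _ _ _ s0 w0X' w0v' (dis _ _ _ d01 w1X').
  have := far _ _ _ _ _ s2 w2X w2v sub2 tU.
  have := far _ _ _ _ _ s2 w2X' w2v' sub2 t'U.
  by clear -cardU cardV card3 D0 D1 D2 Dt; lia.
have Dt : degree e t <= 3.
  apply: leq_trans card3; apply: subset_leq_card; apply/subsetP=> y.
  rewrite inE => ety; have := nbrU _ _ tU ety; have := no_nbr y.
  by rewrite ety /= negbK => yU; rewrite in_setU in_setC yU.
have tC : 0 < #|~: U| by apply/card_gt0P; exists t; rewrite in_setC.
have := side_deg_sum _ _ _ _ _ s0 w0X w0v (dis _ _ _ d01 w1X).
have := side_deg_sum _ _ _ _ _ s0 w0X' w0v' (dis _ _ _ d01 w1X').
have := side_deg_sum _ _ _ _ _ s0 w0X w0v (dis _ _ _ d02 w2X).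
have := side_deg_sum _ _ _ _ _ s0 w0X' w0v' (dis _ _ _ d02 w2X').
have := side_deg_sum _ _ _ _ _ s1 w1X w1v (dis _ _ _ d12 w2X).
have := side_deg_sum _ _ _ _ _ s1 w1X' w1v' (dis _ _ _ d12 w2X').
have := far _ _ _ _ _ s0 w0X w0v sub0 tU.
have := far _ _ _ _ _ s0 w0X' w0v' sub0 tU.
have := far _ _ _ _ _ s1 w1X w1v sub1 tU.
have := far _ _ _ _ _ s1 w1X' w1v' sub1 tU.
have := far _ _ _ _ _ s2 w2X w2v sub2 tU.
have := far _ _ _ _ _ s2 w2X' w2v' sub2 tU.
(* Here [3s <= n - 1] gives [n >= 22], while [6(s - 3) <= n - 1] gives [n <= 16]. *)
by clear -cardU cardV D0 D1 D2 Dt tC; lia.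
Qed.

(** The set [reach a x] is connected, so to meet both [X] and its complement it must contain [v]. *)
Lemma side_inclusion X v u a x : is_side X v u -> v \notin reach a x ->
  ~~ [disjoint reach a x & X] -> reach a x \subset X.
Proof.
move=> /is_sideP[vX uX evu side_uniq] vR /pred0Pn[w /andP[/= wR wX]].
apply/subsetP=> z zR; apply: contraNT vR => zX.
have R_sym : connect_sym (restrict e (reach a x)).
  by apply: sym_connect_sym => y y'; rewrite /restrict /= e_sym [X in _ && X]andbC.
have wz : connect (restrict e (reach a x)) w z.
  apply: (@connect_trans _ _ x); last exact: reach_restrict.
  by rewrite R_sym; apply: reach_restrict.
have [p [q [_ /and3P[epq pR _] pX qX]]] := connect_exit _ _ _ _ wz wX zX.
by have [<- _] := side_uniq _ _ pX qX epq.
Qed.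

(** * Choice of the root *)

Lemma unilateral_root :
  exists a, forall x y, connect (away a) x y || connect (away a) y x.
Proof.
have incomparable_not_root a x y : ~~ connect (away a) x y -> a \notin reach a x.
  by apply: contra; rewrite inE => xa; apply: connect_trans xa (away_root a y).
have [/existsP[z dz]|/existsPn no_pendant] := boolP [exists z, degree e z <= 1].
  exists z => x y; apply/norP => -[xNy yNx].
  have zX := incomparable_not_root _ _ _ xNy.
  have zY := incomparable_not_root _ _ _ yNx.
  have dXY := reach_disjoint _ _ _ zX zY xNy yNx.
  have [v1 [u1 [s1 _ _]]] := reach_side _ _ zX.
  have [v2 [u2 [s2 _ _]]] := reach_side _ _ zY.
  (* Only the root can have degree at most 1, and it lies outside both sets. *)
  have deg X t : z \notin X -> t \in X -> 1 < degree e t.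
    by move=> zNX tX; rewrite ltnNge; apply: contra zNX => dt; rewrite (pendant_unique _ _ dz dt).
  have [w1 [w1' [w1X w1X' w1v w1v' D1]]] := side_edge _ _ _ s1 (fun t => deg _ t zX).
  have [w2 [w2' [w2X w2X' w2v w2v' D2]]] := side_edge _ _ _ s2 (fun t => deg _ t zY).
  (* Both sets have size at least [2((n+6)/4 - 1)], in total [n + 2]. *)
  have := side_deg_sum _ _ _ _ _ s1 w1X w1v zX.
  have := side_deg_sum _ _ _ _ _ s1 w1X' w1v' zX.
  have := side_deg_sum _ _ _ _ _ s2 w2X w2v zY.
  have := side_deg_sum _ _ _ _ _ s2 w2X' w2v' zY.
  have : #|reach z x :|: reach z y| <= #|V| by apply: max_card.
  rewrite cardsU disjoint_setI0 // cards0.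
  by clear -D1 D2 dz; lia.
have {}no_pendant z : 1 < degree e z by rewrite ltnNge.
pose P X := [exists v, exists u, is_side X v u].
have [X0 PX0|noP] := pickP P; last first.
  (* If no set is bounded by a single bridge, any root will do. *)
  have /card_gt0P[a _] : 0 < #|V| by apply: leq_trans n_ge4.
  exists a => x y; apply/norP => -[xNy _].
  have [v [u [sX _ _]]] := reach_side _ _ (incomparable_not_root _ _ _ xNy).
  have /negP[] := negbT (noP (reach a x)).
  by apply/existsP; exists v; apply/existsP; exists u.
case: (@arg_minnP _ X0 P (fun X => #|X|) PX0) => {PX0}X0.
move=> /existsP[v0 /existsP[u0 s0]] X0min.
exists v0 => x y; apply/norP => -[xNy yNx].
have aX := incomparable_not_root _ _ _ xNy.
have aY := incomparable_not_root _ _ _ yNx.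
have dXY := reach_disjoint _ _ _ aX aY xNy yNx.
have [v1 [u1 [s1 a1 c1]]] := reach_side _ _ aX.
have [v2 [u2 [s2 a2 c2]]] := reach_side _ _ aY.
have [v0X0 u0X0 e0 uniq0] := is_sideP _ _ _ s0.
(* A set that avoids [v0] but meets [X0] would lie properly inside [X0], against minimality. *)
have dX0 X v u : is_side X v u -> v0 \notin X ->
    (~~ [disjoint X & X0] -> X \subset X0) -> [disjoint X0 & X].
  move=> sX v0X sub; rewrite disjoint_sym; apply: contraT => /sub XX0.
  have : X \proper X0 by apply/properP; split=> //; exists v0.
  move/proper_card; rewrite ltnNge X0min //.
  by apply/existsP; exists v; apply/existsP; exists u.
have d01 := dX0 _ _ _ s1 aX (side_inclusion _ _ _ _ _ s0 aX).
have d02 := dX0 _ _ _ s2 aY (side_inclusion _ _ _ _ _ s0 aY).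
have outside t : t \notin X0 :|: reach v0 x :|: reach v0 y -> False.
  exact: three_sides s0 s1 s2 d01 d02 dXY no_pendant.
have [v1X u1X e1 _] := is_sideP _ _ _ s1.
have [v2Y u2Y e2 _] := is_sideP _ _ _ s2.
(* If [y] reached [u1], it would reach [x] over the bridge to [v1]. *)
have u1Y : u1 \notin reach v0 y.
  apply: contra yNx; rewrite inE => yu1.
  exact: connect_trans (connect_trans yu1 (connect1 a1)) c1.
have u2X : u2 \notin reach v0 x.
  apply: contra xNy; rewrite inE => xu2.
  exact: connect_trans (connect_trans xu2 (connect1 a2)) c2.
(* By [outside] both bridges start in [X0], which only the bridge [v0u0] leaves. *)
have inX0 t : t \notin reach v0 x -> t \notin reach v0 y -> t \in X0.
  move=> tX tY; apply: contraT => tX0; case: (outside t).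
  by rewrite !in_setU !negb_or tX0 tX.
rewrite e_sym in e1; rewrite e_sym in e2.
have v1X0 : v1 \notin X0 by rewrite (disjointFl d01 v1X).
have v2X0 : v2 \notin X0 by rewrite (disjointFl d02 v2Y).
have [_ v1u0] := uniq0 _ _ (inX0 _ u1X u1Y) v1X0 e1.
have [_ v2u0] := uniq0 _ _ (inX0 _ u2X u2Y) v2X0 e2.
(* Both bridges end in [u0], which would lie in two disjoint sets. *)
by have := disjointFr dXY v1X; rewrite v1u0 -v2u0 v2Y.
Qed.

End ConnectedGraph.

End Reachability.

(** * Colorings from orientations *)

Section Coloring.

Variables (V : finType) (e : rel V).

(** Shortening a walk to a path keeps its steps in [r], so consecutive edges still differ in
    color. *)
Lemma proper_path_connect (c : coloring V) (r : rel V) x y : subrel r e ->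
    (forall u v w, r u v -> r v w -> c [set u; v] != c [set v; w]) ->
  connect r x y -> exists p, proper_path e c x y p.
Proof.
move=> r_sub alt /connectP[p rp ->]; case/shortenP: rp => q rq q_uniq _.
exists q; apply/and4P; split=> //; first exact: sub_path rq.
elim: q x rq {q_uniq} => [|u [|v q] IH] x //= /andP[rxu ruq].
have /= -> := IH u ruq; rewrite andbT.
by case/andP: ruq => ruv _; apply: alt.
Qed.

Hypothesis e_sym : symmetric e.
Variable A : {set V}.
Hypothesis e_bip : forall x y, e x y -> (x \in A) != (y \in A).

(** A coloring takes unordered pairs, so the tail is recovered by quantifying over the arcs of [D].
    The boolean is read as 0 or 1. *)
Definition tail_color (D : rel V) : coloring V :=
  fun E => [exists x, exists y, [&& D x y, x \in A & E == [set x; y]]].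

Lemma tail_colorE (D : rel V) x y : (forall u v, D u v -> ~~ D v u) ->
  D x y -> tail_color D [set x; y] = (x \in A).
Proof.
move=> D_anti Dxy; congr nat_of_bool; apply/idP/idP => [|xA]; last first.
  by apply/existsP; exists x; apply/existsP; exists y; rewrite Dxy xA eqxx.
move=> /existsP[u /existsP[v /and3P[Duv uA /eqP/setP E]]].
move: (E x) (E y); rewrite !inE !eqxx orbT => /esym/orP[/eqP->//|/eqP xv].
move=> /esym/orP[/eqP yu|/eqP yv].
  by move: Duv; rewrite -xv -yu (negPf (D_anti _ _ Dxy)).
by have := D_anti _ _ Dxy; rewrite xv yv in Dxy *; rewrite Dxy.
Qed.

(** The tails of consecutive arcs are adjacent, hence on different sides. If only [y] reaches [x],
    the path is walked backwards. *)
Lemma orientation_coloring (D : rel V) : subrel D e ->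
    (forall u v, D u v -> ~~ D v u) ->
    (forall x y, connect D x y || connect D y x) ->
  proper_connection_coloring e (tail_color D).
Proof.
move=> D_sub D_anti D_unil x y _.
have alt u v w : D u v -> D v w ->
    tail_color D [set u; v] != tail_color D [set v; w].
  move=> Duv Dvw; rewrite !tail_colorE //.
  by have := e_bip _ _ (D_sub _ _ Duv); do 2!case: (_ \in A).
have /orP[xy|yx] := D_unil x y; first exact: proper_path_connect alt xy.
apply: (@proper_path_connect _ [rel u v | D v u]); last by rewrite connect_revE.
  by move=> u v /= /D_sub; rewrite e_sym.
move=> u v w /= Dvu Dwv.
by rewrite [[set u; v]]setUC [[set v; w]]setUC eq_sym; apply: alt.
Qed.

Lemma num_colors_tail_color D : num_colors e (tail_color D) <= 2.
Proof.
apply: (@uniq_leq_size _ _ [:: 0; 1]); first exact: undup_uniq.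
move=> k; rewrite mem_undup => /mapP[E _ ->].
by rewrite !inE /tail_color; case: [exists x, _].
Qed.

(** Bipartite graphs have no triangle, so some two vertices are nonadjacent; a proper path between
    them has two consecutive edges. *)
Lemma num_colors_ge2 c : 2 < #|V| -> proper_connection_coloring e c ->
  2 <= num_colors e c.
Proof.
move=> /card_gt2P[x [y [z [_ [xy yz zx]]]]] c_proper.
have [u [v [uv nuv]]] : exists u v, u != v /\ ~~ e u v.
  have [/e_bip exy|nxy] := boolP (e x y); last by exists x, y.
  have [/e_bip eyz|nyz] := boolP (e y z); last by exists y, z.
  have [/e_bip ezx|nzx] := boolP (e z x); last by exists z, x.
  by move: exy eyz ezx; do 3!case: (_ \in A).
have [p /and4P[]] := c_proper _ _ uv.
case: p => [|a [|b p]] /=.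
- by move=> _ _ /eqP uv'; rewrite uv' eqxx in uv.
- by rewrite andbT => eua _ /eqP av; rewrite -av eua in nuv.
move=> /and3P[eua eab _] _ _ /andP[cab _].
rewrite -[2]/(size [:: c [set u; a]; c [set a; b]]).
apply: uniq_leq_size; first by rewrite /= inE cab.
have edge_mem s t : e s t -> c [set s; t] \in undup [seq c E | E <- enum (edges e)].
  move=> est; rewrite mem_undup; apply: map_f; rewrite mem_enum.
  by apply/imsetP; exists (s, t); rewrite ?inE.
by move=> k; rewrite !inE => /orP[]/eqP->; apply: edge_mem.
Qed.

End Coloring.

Theorem theorem1p2 (V : finType) (e : rel V)
    (e_sym : symmetric e) (e_irr : irreflexive e)
    (Gconn : connected_graph e) (Gbip : bipartite e)
    (n_ge4 : 4 <= #|V|)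
    (deg_sum : forall x y : V, x != y -> ~~ e x y ->
       (((#|V| + 6)%:R / 4%:R : rat) <= (degree e x + degree e y)%:R)%R) :
  is_pc e 2.
Proof.
have [_ e_conn] := Gconn; have [A e_bip] := Gbip.
(* The denominator is cleared, so that the counting runs in [nat]. *)
have deg_sumN x y : x != y -> ~~ e x y ->
    #|V| + 6 <= 4 * (degree e x + degree e y).
  move=> xy nxy; have := deg_sum _ _ xy nxy.
  by rewrite ler_pdivrMr ?ltr0n // -natrM ler_nat mulnC.
have [a a_unil] := unilateral_root V e e_sym e_irr e_conn A e_bip n_ge4 deg_sumN.
have [D [D_sub D_anti D_conn]] := bridge_orientation V e e_sym e_irr a.
have lower c : proper_connection_coloring e c -> 2 <= num_colors e c.
  by apply: (num_colors_ge2 V e A e_bip); apply: leq_trans n_ge4.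
have D_proper : proper_connection_coloring e (tail_color V A D).
  apply: orientation_coloring => // x y.
  by have /orP[/D_conn->|/D_conn->] := a_unil x y; rewrite ?orbT.
split=> //; exists (tail_color V A D) => //.
by apply/eqP; rewrite eqn_leq lower // num_colors_tail_color.
Qed.
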